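(* $$\frac{935\sqrt3}{128}=\sum_{j=0}^{\infty}\left(\frac14\right)^{j}\frac{\left(\frac12\right)_j\left(\frac53\right)_j\left(\frac73\right)_j}{(1)_j\left(\frac{23}{12}\right)_j\left(\frac{29}{12}\right)_j}\,(9j+10).$$
   Context: $(x)_0=1$ and $(x)_j=x(x+1)\cdots(x+j-1)$ for positive integers $j$ (rising factorial). *)

(* Defs.v *)
From Stdlib Require Import Reals.
From Coquelicot Require Import Coquelicot.
Open Scope R_scope.

(* (x)_j = x (x+1) ... (x+j-1), with (x)_0 = 1. *)
Fixpoint rising (x : R) (j : nat) : R :=
  match j with
  | O => 1
  | S k => rising x k * (x + INR k)
  end.

(* Main.v *)
Require Import Defs.
From Stdlib Require Import Reals Lra Lia.
From Coquelicot Require Import Coquelicot.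
Open Scope R_scope.

(** The series is three times the member c = 7/3 of the family
      S(c) = sum_j (1/4)^j (1/2)_j ((c+1)/2)_j (c)_j (3j+c+1)
                   / ((1)_j ((c+3/2)/2)_j ((c+5/2)/2)_j).
    A Wilf-Zeilberger certificate ([term_telescopes]) gives the recurrence
      (c+1)^2 S(c+2) = (c+3/2)(c+5/2) S(c)         ([Series_term_shift]),
    while S(0) = 1 because (0)_j vanishes for j > 0, so S is an explicit
    product at every even natural number. As S is nondecreasing in c
    ([Series_term_le]), S(c+2n) lies between two such explicit values, whose
    ratio tends to 1 as n grows. Iterating the recurrence down from c + 2n to
    c then determines S(c) ([Series_term_closed_form]).

    The answer is really a quotient of Gamma values, but its evaluation only
    uses limits of finite products. Write psi_x(n) = (x+1/2)_n / (x)_n.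
    Monotonicity shows that psi_x(n)^2 / n converges to a positive rate L_x,
    which stands for (Gamma(x) / Gamma(x+1/2))^2, and the recurrence yields
      S(c)^2 L_{c+1} L_{(c+1)/2} = L_1 L_{1/2} = 4.
    For c = 7/3 the product L_{10/3} L_{5/3} is a rational multiple of
    L_{1/3} L_{2/3}, by the shift x -> x+1. Splitting (1)_{3n} and
    (1/2)_{3n} into residue classes modulo 3 expresses
    psi_{1/3}(n) psi_{2/3}(n) through psi_{1/2}(n) / psi_{1/2}(3n), whose
    square tends to 1/3 whatever the value of L_{1/2}
    ([half_step_rate_thirds]). That 3 is the source of the square root. *)

(** * Ratios of rising factorials at distance one half *)

Lemma rising_pos (x : R) (n : nat) : 0 < x -> 0 < rising x n.
Proof.
  intros Hx; induction n as [|n IH]; simpl; [lra|].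
  pose proof (pos_INR n); apply Rmult_lt_0_compat; lra.
Qed.

Lemma is_lim_seq_shift_ratio (a b : R) :
  is_lim_seq (fun n => (INR n + a) / (INR n + b)) 1.
Proof.
  assert (Hinv : is_lim_seq (fun n => / (INR n + b)) 0).
  { replace (Finite 0) with (Rbar_inv p_infty) by reflexivity.
    apply is_lim_seq_inv; [|discriminate].
    apply (is_lim_seq_plus _ _ p_infty b p_infty);
      [apply is_lim_seq_INR | apply is_lim_seq_const | reflexivity]. }
  apply is_lim_seq_ext_loc with (fun n => 1 + (a - b) * / (INR n + b)).
  - destruct (nfloor_ex (Rabs b) (Rabs_pos b)) as [m [_ Hm]].
    exists (S m); intros n Hn.
    apply le_INR in Hn; rewrite S_INR in Hn.
    pose proof (Rcomplements.Rabs_maj2 b).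
    field; lra.
  - replace (Finite 1) with (Finite (1 + (a - b) * 0)) by (f_equal; ring).
    apply is_lim_seq_plus'; [apply is_lim_seq_const|].
    apply is_lim_seq_mult'; [apply is_lim_seq_const | exact Hinv].
Qed.

Definition half_step (x : R) (n : nat) : R := rising (x + 1 / 2) n / rising x n.

Lemma half_step_S (x : R) (n : nat) : 0 < x ->
  half_step x (S n) = half_step x n * ((x + 1 / 2 + INR n) / (x + INR n)).
Proof.
  intros Hx; unfold half_step; simpl.
  pose proof (rising_pos x n Hx); pose proof (pos_INR n).
  field; lra.
Qed.

Lemma half_step_pos (x : R) (n : nat) : 0 < x -> 0 < half_step x n.
Proof.
  intros Hx; unfold half_step; apply Rdiv_lt_0_compat; apply rising_pos; lra.
Qed.

(** This is (Gamma(x) / Gamma(x+1/2))^2 when x > 1/4. *)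
Definition half_step_rate (x : R) : R :=
  real (Lim_seq (fun n => half_step x n ^ 2 / INR n)).

(** Since psi^2 / (n + x) increases in n whereas psi^2 / (n + x - 1/4)
    decreases, the first is bounded by the initial value of the second. With
    the offset x - 1/4 the n-dependence in the numerator of the increment
    cancels, leaving a constant sign; x > 1/4 keeps this offset positive. *)
Lemma half_step_ex_lim (x : R) : 1 / 4 < x ->
  exists l, 0 < l /\ is_lim_seq (fun n => half_step x n ^ 2 / INR n) l.
Proof.
  intros Hx.
  set (v := fun n => half_step x n ^ 2 / (INR n + x)).
  assert (Hincr : forall n, v n <= v (S n)).
  { intros n; unfold v; rewrite half_step_S, S_INR by lra.
    pose proof (half_step_pos x n ltac:(lra)); pose proof (pos_INR n).
    apply Rminus_le.
    replace (_ - _) with (- (half_step x n ^ 2 * (INR n / 4 + x / 4)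
      / ((INR n + x) * (INR n + x) ^ 2 * (INR n + 1 + x)))) by (field; lra).
    apply Ropp_le_cancel; rewrite Ropp_involutive, Ropp_0.
    apply Rdiv_le_0_compat; [nra|].
    repeat apply Rmult_lt_0_compat; try lra; apply pow_lt; lra. }
  assert (Hdecr : forall n,
    half_step x n ^ 2 / (INR n + x - 1 / 4) <= / (x - 1 / 4)).
  { induction n as [|n IH].
    - unfold half_step; simpl; apply Req_le; field; lra.
    - apply Rle_trans with (2 := IH).
      rewrite half_step_S, S_INR by lra.
      pose proof (half_step_pos x n ltac:(lra)); pose proof (pos_INR n).
      apply Rminus_le.
      replace (_ - _) with (- (half_step x n ^ 2 * (1 / 16)
        / ((INR n + x - 1 / 4) * (INR n + x) ^ 2 * (INR n + 1 + x - 1 / 4))))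
        by (field; lra).
      apply Ropp_le_cancel; rewrite Ropp_involutive, Ropp_0.
      apply Rdiv_le_0_compat; [nra|].
      repeat apply Rmult_lt_0_compat; try lra; apply pow_lt; lra. }
  assert (Hbound : forall n, v n <= / (x - 1 / 4)).
  { intros n; apply Rle_trans with (2 := Hdecr n); unfold v, Rdiv.
    pose proof (half_step_pos x n ltac:(lra)); pose proof (pos_INR n).
    apply Rmult_le_compat_l; [apply pow_le; lra|].
    apply Rinv_le_contravar; lra. }
  destruct (ex_finite_lim_seq_incr v _ Hincr Hbound) as [l Hl].
  exists l; split.
  - apply Rlt_le_trans with (v O).
    + unfold v, half_step; simpl. apply Rdiv_lt_0_compat; lra.
    + apply (is_lim_seq_incr_compare v l Hl Hincr).
  - apply is_lim_seq_ext_loc with (fun n => v n * ((INR n + x) / (INR n + 0))).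
    + exists 1%nat; intros n Hn; apply le_INR in Hn; simpl in Hn.
      unfold v; field; lra.
    + replace (Finite l) with (Finite (l * 1)) by (f_equal; ring).
      apply is_lim_seq_mult'; [exact Hl | apply is_lim_seq_shift_ratio].
Qed.

Lemma half_step_lim (x : R) : 1 / 4 < x ->
  is_lim_seq (fun n => half_step x n ^ 2 / INR n) (half_step_rate x).
Proof.
  intros Hx; destruct (half_step_ex_lim x Hx) as (l & _ & Hl).
  unfold half_step_rate; now rewrite (is_lim_seq_unique _ _ Hl).
Qed.

Lemma half_step_rate_pos (x : R) : 1 / 4 < x -> 0 < half_step_rate x.
Proof.
  intros Hx; destruct (half_step_ex_lim x Hx) as (l & Hpos & Hl).
  unfold half_step_rate; now rewrite (is_lim_seq_unique _ _ Hl).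
Qed.

(** Sampling along multiples of [m] leaves the rate unchanged; this is what
    makes multiplication formulas computable without knowing the rate. *)
Lemma half_step_lim_subseq (x : R) (m : nat) : 1 / 4 < x -> (0 < m)%nat ->
  is_lim_seq (fun n => half_step x (m * n) ^ 2 / INR (m * n)) (half_step_rate x).
Proof.
  intros Hx Hm.
  apply (is_lim_seq_subseq (fun n => half_step x n ^ 2 / INR n) _
    (fun n => (m * n)%nat)); [|now apply half_step_lim].
  apply eventually_subseq; intros n; nia.
Qed.

Lemma lim_unique (u : nat -> R) (a b : R) :
  is_lim_seq u a -> is_lim_seq u b -> a = b.
Proof.
  intros Ha Hb; apply is_lim_seq_unique in Ha, Hb; congruence.
Qed.

(** The analogue of Gamma(x+1) = x Gamma(x). *)
Lemma half_step_rate_shift (x : R) : 1 / 4 < x ->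
  half_step_rate (x + 1) = half_step_rate x * (x / (x + 1 / 2)) ^ 2.
Proof.
  intros Hx.
  apply (lim_unique (fun n => half_step (x + 1) n ^ 2 / INR n));
    [apply half_step_lim; lra|].
  assert (Hexact : forall n, half_step (x + 1) n =
    half_step x n * (x / (x + 1 / 2)) * ((INR n + (x + 1 / 2)) / (INR n + x))).
  { induction n as [|n IH].
    - unfold half_step; simpl; field; lra.
    - rewrite !half_step_S, IH, S_INR by lra.
      pose proof (pos_INR n); field; lra. }
  apply is_lim_seq_ext with (fun n => half_step x n ^ 2 / INR n *
    (x / (x + 1 / 2)) ^ 2 *
    ((INR n + (x + 1 / 2)) / (INR n + x) * ((INR n + (x + 1 / 2)) / (INR n + x)))).
  - intros n; rewrite Hexact; unfold Rdiv; ring.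
  - replace (Finite _) with (Finite
      (half_step_rate x * (x / (x + 1 / 2)) ^ 2 * (1 * 1))) by (f_equal; ring).
    apply is_lim_seq_mult';
      [apply is_lim_seq_mult'; [now apply half_step_lim | apply is_lim_seq_const]
      | apply is_lim_seq_mult'; apply is_lim_seq_shift_ratio].
Qed.

(** The product telescopes: psi_1(n) psi_{1/2}(n) = (3/2)_n / (1/2)_n
    = 2n + 1. *)
Lemma half_step_rate_1_half : half_step_rate 1 * half_step_rate (1 / 2) = 4.
Proof.
  assert (Hexact : forall n, half_step 1 n * half_step (1 / 2) n = 2 * INR n + 1).
  { induction n as [|n IH].
    - unfold half_step; simpl; field.
    - rewrite !half_step_S, S_INR by lra.
      pose proof (pos_INR n).
      transitivity (half_step 1 n * half_step (1 / 2) n *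
        ((2 * INR n + 3) / (2 * INR n + 1))); [field; lra|].
      rewrite IH; field; lra. }
  apply (lim_unique (fun n => half_step 1 n ^ 2 / INR n *
    (half_step (1 / 2) n ^ 2 / INR n))).
  - apply is_lim_seq_mult'; apply half_step_lim; lra.
  - apply is_lim_seq_ext_loc with (fun n => 4 *
      ((INR n + 1 / 2) / (INR n + 0) * ((INR n + 1 / 2) / (INR n + 0)))).
    + exists 1%nat; intros n Hn; apply le_INR in Hn; simpl in Hn.
      transitivity ((half_step 1 n * half_step (1 / 2) n) ^ 2 / INR n ^ 2).
      * rewrite Hexact; field; lra.
      * field; lra.
    + replace (Finite 4) with (Finite (4 * (1 * 1))) by (f_equal; ring).
      apply is_lim_seq_mult'; [apply is_lim_seq_const|].
      apply is_lim_seq_mult'; apply is_lim_seq_shift_ratio.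
Qed.

(** From (3n)! = 27^n (1/3)_n (2/3)_n (1)_n and
    (1/2)_{3n} = 27^n (1/6)_n (1/2)_n (5/6)_n one gets
    psi_{1/3}(n) psi_{2/3}(n) = (6n+1) psi_{1/2}(n) / psi_{1/2}(3n). Its square
    divided by n^2 tends to 36/3. *)
Lemma half_step_rate_thirds :
  half_step_rate (1 / 3) * half_step_rate (2 / 3) = 12.
Proof.
  assert (Hexact : forall n, half_step (1 / 3) n * half_step (2 / 3) n *
    half_step (1 / 2) (3 * n) = (6 * INR n + 1) * half_step (1 / 2) n).
  { induction n as [|n IH].
    - unfold half_step; simpl; field.
    - replace (3 * S n)%nat with (S (S (S (3 * n)))) by lia.
      rewrite !half_step_S, !S_INR, mult_INR by lra.
      pose proof (pos_INR n); simpl (INR 3).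
      transitivity (half_step (1 / 3) n * half_step (2 / 3) n *
        half_step (1 / 2) (3 * n) * ((6 * INR n + 7) / (6 * INR n + 1) *
        ((2 * INR n + 2) / (2 * INR n + 1)))); [field; lra|].
      rewrite IH; field; lra. }
  pose proof (half_step_rate_pos (1 / 2) ltac:(lra)) as Hpos.
  apply Rmult_eq_reg_r with (half_step_rate (1 / 2)); [|lra].
  apply (lim_unique (fun n => half_step (1 / 3) n ^ 2 / INR n *
    (half_step (2 / 3) n ^ 2 / INR n) *
    (half_step (1 / 2) (3 * n) ^ 2 / INR (3 * n)))).
  - apply is_lim_seq_mult';
      [apply is_lim_seq_mult'; apply half_step_lim; lra
      | apply half_step_lim_subseq; [lra | lia]].
  - apply is_lim_seq_ext_loc with (fun n => 12 *
      ((INR n + 1 / 6) / (INR n + 0) * ((INR n + 1 / 6) / (INR n + 0))) *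
      (half_step (1 / 2) n ^ 2 / INR n)).
    + exists 1%nat; intros n Hn; apply le_INR in Hn; simpl in Hn.
      rewrite mult_INR; simpl (INR 3).
      transitivity ((half_step (1 / 3) n * half_step (2 / 3) n *
        half_step (1 / 2) (3 * n)) ^ 2 / (3 * INR n ^ 3)).
      * rewrite Hexact; field; lra.
      * field; lra.
    + replace (Finite _) with (Finite (12 * (1 * 1) * half_step_rate (1 / 2)))
        by (f_equal; ring).
      apply is_lim_seq_mult'; [|apply half_step_lim; lra].
      apply is_lim_seq_mult'; [apply is_lim_seq_const|].
      apply is_lim_seq_mult'; apply is_lim_seq_shift_ratio.
Qed.

(** * The family of series *)

Definition coef (c : R) (j : nat) : R :=
  (1 / 4) ^ j *
  ((rising (1 / 2) j * rising ((c + 1) / 2) j * rising c j) /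
   (rising 1 j * rising ((c + 3 / 2) / 2) j * rising ((c + 5 / 2) / 2) j)).

Definition term (c : R) (j : nat) : R := coef c j * (3 * INR j + c + 1).

Lemma coef_S (c : R) (j : nat) : 0 <= c ->
  coef c (S j) = coef c j *
    (1 / 2 * ((1 / 2 + INR j) / (1 + INR j)) *
     ((c + 1 + 2 * INR j) / (c + 3 / 2 + 2 * INR j)) *
     ((c + INR j) / (c + 5 / 2 + 2 * INR j))).
Proof.
  intros Hc; unfold coef; simpl.
  pose proof (pos_INR j).
  pose proof (rising_pos 1 j ltac:(lra)).
  pose proof (rising_pos ((c + 3 / 2) / 2) j ltac:(lra)).
  pose proof (rising_pos ((c + 5 / 2) / 2) j ltac:(lra)).
  field; lra.
Qed.

Lemma frac_bounds (a b : R) : 0 <= a -> 0 < b -> a <= b -> 0 <= a / b <= 1.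
Proof.
  intros Ha Hb Hab; split; [now apply Rdiv_le_0_compat|].
  apply Rmult_le_reg_r with b; [lra|].
  unfold Rdiv; rewrite Rmult_assoc, Rinv_l; lra.
Qed.

Lemma coef_bounds (c : R) (j : nat) : 0 <= c -> 0 <= coef c j <= (1 / 2) ^ j.
Proof.
  intros Hc; induction j as [|j IH].
  - unfold coef; simpl; lra.
  - rewrite coef_S by lra; pose proof (pos_INR j).
    destruct (frac_bounds (1 / 2 + INR j) (1 + INR j)
      ltac:(lra) ltac:(lra) ltac:(lra)) as [Ha0 Ha1].
    destruct (frac_bounds (c + 1 + 2 * INR j) (c + 3 / 2 + 2 * INR j)
      ltac:(lra) ltac:(lra) ltac:(lra)) as [Hb0 Hb1].
    destruct (frac_bounds (c + INR j) (c + 5 / 2 + 2 * INR j)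
      ltac:(lra) ltac:(lra) ltac:(lra)) as [Hd0 Hd1].
    revert Ha0 Ha1 Hb0 Hb1 Hd0 Hd1.
    generalize ((1 / 2 + INR j) / (1 + INR j))
      ((c + 1 + 2 * INR j) / (c + 3 / 2 + 2 * INR j))
      ((c + INR j) / (c + 5 / 2 + 2 * INR j)).
    intros u v w Hu0 Hu1 Hv0 Hv1 Hw0 Hw1.
    assert (Huv : 0 <= u * v <= 1) by nra.
    assert (Huvw : 0 <= u * v * w <= 1) by nra.
    simpl; split.
    + replace (_ * (1 / 2 * u * v * w)) with (coef c j * (u * v * w) / 2) by field.
      nra.
    + replace (_ * (1 / 2 * u * v * w)) with (coef c j * (u * v * w) / 2) by field.
      nra.
Qed.

Lemma cross_mult_le (a b a' b' : R) :
  0 < b -> 0 < b' -> a * b' <= a' * b -> a / b <= a' / b'.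
Proof.
  intros Hb Hb' H; apply Rminus_le.
  replace (a / b - a' / b') with (- ((a' * b - a * b') / (b * b'))) by (field; lra).
  apply Ropp_le_cancel; rewrite Ropp_involutive, Ropp_0.
  apply Rdiv_le_0_compat; [lra | now apply Rmult_lt_0_compat].
Qed.

Lemma coef_le (c c' : R) (j : nat) : 0 <= c -> c <= c' -> coef c j <= coef c' j.
Proof.
  intros Hc Hcc; induction j as [|j IH].
  - unfold coef; simpl; lra.
  - rewrite !coef_S by lra; pose proof (pos_INR j).
    assert (Hb : (c + 1 + 2 * INR j) / (c + 3 / 2 + 2 * INR j) <=
                 (c' + 1 + 2 * INR j) / (c' + 3 / 2 + 2 * INR j)).
    { apply cross_mult_le; nra. }
    assert (Hd : (c + INR j) / (c + 5 / 2 + 2 * INR j) <=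
                 (c' + INR j) / (c' + 5 / 2 + 2 * INR j)).
    { apply cross_mult_le; nra. }
    pose proof (proj1 (coef_bounds c j Hc)).
    assert (0 <= 1 / 2 * ((1 / 2 + INR j) / (1 + INR j))).
    { apply Rmult_le_pos; [lra|]. apply Rdiv_le_0_compat; lra. }
    assert (0 <= (c + 1 + 2 * INR j) / (c + 3 / 2 + 2 * INR j))
      by (apply Rdiv_le_0_compat; lra).
    assert (0 <= (c + INR j) / (c + 5 / 2 + 2 * INR j))
      by (apply Rdiv_le_0_compat; lra).
    apply Rmult_le_compat; [assumption | | exact IH |].
    + apply Rmult_le_pos; [now apply Rmult_le_pos | assumption].
    + apply Rmult_le_compat; [now apply Rmult_le_pos | assumption | | exact Hd].
      apply Rmult_le_compat_l; assumption.
Qed.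

(** Bernoulli's inequality in the form n <= 2 (3/2)^n trades a linear factor
    for a slower geometric decay. *)
Lemma linear_pow_half (a b : R) (n : nat) : 0 <= a -> 0 <= b ->
  (a * INR n + b) * (1 / 2) ^ n <= (2 * a + b) * (3 / 4) ^ n.
Proof.
  intros Ha Hb.
  assert (Hn : INR n <= 2 * (3 / 2) ^ n).
  { induction n as [|n IH]; [simpl; lra|].
    rewrite S_INR; simpl.
    assert (1 <= (3 / 2) ^ n) by (apply pow_R1_Rle; lra). lra. }
  assert (H1 : 1 <= (3 / 2) ^ n) by (apply pow_R1_Rle; lra).
  replace (3 / 4) with (3 / 2 * (1 / 2)) by field.
  rewrite Rpow_mult_distr, <- Rmult_assoc.
  apply Rmult_le_compat_r; [apply pow_le; lra | nra].
Qed.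

Lemma term_nonneg (c : R) (j : nat) : 0 <= c -> 0 <= term c j.
Proof.
  intros Hc; unfold term; pose proof (pos_INR j).
  apply Rmult_le_pos; [apply coef_bounds|]; lra.
Qed.

Lemma ex_series_term (c : R) : 0 <= c -> ex_series (term c).
Proof.
  intros Hc.
  apply (ex_series_le (K := R_AbsRing) (V := R_CompleteNormedModule) (term c)
    (fun j => (2 * 3 + (c + 1)) * (3 / 4) ^ j)).
  - intros j; change (Rabs (term c j) <= (2 * 3 + (c + 1)) * (3 / 4) ^ j).
    rewrite Rabs_pos_eq by now apply term_nonneg.
    apply Rle_trans with (2 := linear_pow_half 3 (c + 1) j ltac:(lra) ltac:(lra)).
    unfold term; rewrite Rmult_comm, <- Rplus_assoc.
    pose proof (pos_INR j).
    apply Rmult_le_compat_l; [lra | now apply coef_bounds].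
  - apply (ex_series_scal_l (V := R_NormedModule) (2 * 3 + (c + 1))
      (fun j => (3 / 4) ^ j)).
    apply ex_series_geom; rewrite Rabs_pos_eq; lra.
Qed.

Lemma Series_term_nonneg (c : R) : 0 <= c -> 0 <= Series (term c).
Proof.
  intros Hc; rewrite <- (Rmult_0_l (Series (fun _ => 0))), <- Series_scal_l.
  apply Series_le; [|now apply ex_series_term].
  intros j; rewrite Rmult_0_l; split; [lra | now apply term_nonneg].
Qed.

(** Each ratio of consecutive coefficients is nondecreasing in [c], and so is
    the linear factor. This monotonicity lets the recurrence in steps of 2
    compare the values at 7/3 + 2n with those at even integers. *)
Lemma Series_term_le (c c' : R) : 0 <= c -> c <= c' ->
  Series (term c) <= Series (term c').
Proof.
  intros Hc Hcc; apply Series_le; [|apply ex_series_term; lra].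
  intros j; split; [now apply term_nonneg|].
  unfold term; pose proof (pos_INR j).
  apply Rmult_le_compat; [now apply coef_bounds | lra | now apply coef_le | lra].
Qed.

Lemma Series_term_0 : Series (term 0) = 1.
Proof.
  rewrite Series_incr_1 by (apply ex_series_term; lra).
  assert (Hz : forall j, rising 0 (S j) = 0).
  { induction j as [|j IH]; simpl in *; [ring | rewrite IH; ring]. }
  rewrite (Series_ext _ (fun _ => 0 * 0)).
  - rewrite Series_scal_l; unfold term, coef; simpl; field.
  - intros j; unfold term, coef; rewrite Hz; unfold Rdiv; ring.
Qed.

(** * The recurrence in steps of two *)

(** Stated without division so that it also holds at c = 0, where
    [coef c j] vanishes for j > 0. *)
Lemma coef_shift (c : R) (j : nat) : 0 <= c ->
  coef c j * ((c + INR j) * (c + INR j + 1) * (c + 1 + 2 * INR j) *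
              (c + 3 / 2) * (c + 5 / 2)) =
  coef (c + 2) j * (c * (c + 1) ^ 2 *
    (c + 3 / 2 + 2 * INR j) * (c + 5 / 2 + 2 * INR j)).
Proof.
  intros Hc; induction j as [|j IH].
  - unfold coef; simpl; field.
  - rewrite !coef_S, S_INR by lra; pose proof (pos_INR j).
    transitivity (coef c j * ((c + INR j) * (c + INR j + 1) * (c + 1 + 2 * INR j) *
      (c + 3 / 2) * (c + 5 / 2)) *
      (1 / 2 * ((1 / 2 + INR j) / (1 + INR j)) * (c + 3 + 2 * INR j) *
       (c + 2 + INR j) / (c + 3 / 2 + 2 * INR j) / (c + 5 / 2 + 2 * INR j)));
      [field; lra|].
    rewrite IH; field; lra.
Qed.

(** In terms of [coef c] the certificate is
    - j (2j+1) (c+3/2) (c+5/2) coef c j / c; passing to [coef (c + 2)] by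
    [coef_shift] removes the pole at c = 0, the starting point of the
    iteration. At j = 0 the leading factor j gives the value 0. *)
Definition certificate (c : R) (j : nat) : R :=
  - (INR j * (2 * INR j + 1) * coef (c + 2) j * (c + 1) ^ 2 *
     (c + 3 / 2 + 2 * INR j) * (c + 5 / 2 + 2 * INR j) /
     ((c + INR j) * (c + INR j + 1) * (c + 1 + 2 * INR j))).

Lemma term_telescopes (c : R) (n : nat) : 0 <= c ->
  sum_n (fun j => (c + 1) ^ 2 * term (c + 2) j -
                  (c + 3 / 2) * (c + 5 / 2) * term c j) n =
  certificate c (S n).
Proof.
  intros Hc; induction n as [|n IH].
  - rewrite sum_O; unfold term, certificate; rewrite coef_S by lra.
    unfold coef; simpl; field; lra.
  - rewrite sum_Sn, IH.
    change (certificate c (S n) + ((c + 1) ^ 2 * term (c + 2) (S n) -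
      (c + 3 / 2) * (c + 5 / 2) * term c (S n)) = certificate c (S (S n))).
    assert (Hcoef : coef c (S n) = coef (c + 2) (S n) * (c * (c + 1) ^ 2 *
      (c + 3 / 2 + 2 * INR (S n)) * (c + 5 / 2 + 2 * INR (S n))) /
      ((c + INR (S n)) * (c + INR (S n) + 1) * (c + 1 + 2 * INR (S n)) *
       (c + 3 / 2) * (c + 5 / 2))).
    { rewrite <- coef_shift by lra; rewrite S_INR; pose proof (pos_INR n).
      field; lra. }
    unfold term, certificate; rewrite Hcoef, (coef_S _ (S n)) by lra.
    rewrite (S_INR (S n)), (S_INR n); pose proof (pos_INR n).
    generalize (coef (c + 2) (S n)); intros p; field; lra.
Qed.

Lemma certificate_lim (c : R) : 0 <= c ->
  is_lim_seq (fun n => certificate c (S n)) 0.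
Proof.
  intros Hc.
  apply (is_lim_seq_incr_1 (certificate c)).
  apply is_lim_seq_abs_0.
  apply is_lim_seq_le_le with (fun _ => 0)
    (fun n => 6 * (c + 1) ^ 2 * ((2 * 2 + 1) * (3 / 4) ^ n)).
  - intros n; split; [apply Rabs_pos|].
    apply Rle_trans with
      (6 * (c + 1) ^ 2 * ((2 * INR n + 1) * (1 / 2) ^ n)).
    2: { apply Rmult_le_compat_l; [nra | apply linear_pow_half; lra]. }
    (* At n = 0 and c = 0 the denominator vanishes, hence the separate case. *)
    destruct n as [|n].
    { unfold certificate; simpl; unfold Rdiv; rewrite !Rmult_0_l, Ropp_0, Rabs_R0; nra. }
    unfold certificate; rewrite Rabs_Ropp.
    assert (Hn : 1 <= INR (S n)) by (rewrite S_INR; pose proof (pos_INR n); lra).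
    revert Hn; generalize (coef_bounds (c + 2) (S n) ltac:(lra)).
    generalize (coef (c + 2) (S n)) ((1 / 2) ^ S n) (INR (S n)).
    intros p h x Hp Hx.
    destruct (frac_bounds x (c + x) ltac:(lra) ltac:(lra) ltac:(lra)) as [Ha0 Ha1].
    destruct (frac_bounds (c + 3 / 2 + 2 * x) (2 * (c + 1 + 2 * x))
      ltac:(lra) ltac:(lra) ltac:(lra)) as [Hb0 Hb1].
    destruct (frac_bounds (c + 5 / 2 + 2 * x) (3 * (c + x + 1))
      ltac:(lra) ltac:(lra) ltac:(lra)) as [Hd0 Hd1].
    replace (x * _ * _ * _ * _ * _ / _) with
      (6 * (c + 1) ^ 2 * ((2 * x + 1) * (p * (x / (c + x) *
        ((c + 3 / 2 + 2 * x) / (2 * (c + 1 + 2 * x)) *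
         ((c + 5 / 2 + 2 * x) / (3 * (c + x + 1))))))))
      by (field; lra).
    revert Ha0 Ha1 Hb0 Hb1 Hd0 Hd1.
    generalize (x / (c + x)) ((c + 3 / 2 + 2 * x) / (2 * (c + 1 + 2 * x)))
      ((c + 5 / 2 + 2 * x) / (3 * (c + x + 1))).
    intros u v w Hu0 Hu1 Hv0 Hv1 Hw0 Hw1.
    assert (Hvw : 0 <= v * w <= 1) by nra.
    assert (Huvw : 0 <= u * (v * w) <= 1) by nra.
    assert (Hpuvw : 0 <= p * (u * (v * w)) <= h) by nra.
    rewrite Rabs_pos_eq.
    + apply Rmult_le_compat_l; [nra|]; apply Rmult_le_compat_l; lra.
    + apply Rmult_le_pos; [nra|]; apply Rmult_le_pos; lra.
  - apply is_lim_seq_const.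
  - replace (Finite 0) with (Finite (6 * (c + 1) ^ 2 * ((2 * 2 + 1) * 0)))
      by (f_equal; ring).
    apply is_lim_seq_mult'; [apply is_lim_seq_const|].
    apply is_lim_seq_mult'; [apply is_lim_seq_const|].
    apply is_lim_seq_geom; rewrite Rabs_pos_eq; lra.
Qed.

Lemma Series_term_shift (c : R) : 0 <= c ->
  (c + 1) ^ 2 * Series (term (c + 2)) =
  (c + 3 / 2) * (c + 5 / 2) * Series (term c).
Proof.
  intros Hc.
  pose proof (ex_series_term c Hc) as Hex.
  pose proof (ex_series_term (c + 2) ltac:(lra)) as Hex2.
  rewrite <- !Series_scal_l.
  apply Rminus_diag_uniq.
  rewrite <- Series_minus by now apply (ex_series_scal_l (V := R_NormedModule)).
  apply is_series_unique.
  change (is_lim_seq (sum_n (fun j => (c + 1) ^ 2 * term (c + 2) j -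
    (c + 3 / 2) * (c + 5 / 2) * term c j)) 0).
  apply (is_lim_seq_ext (fun n => certificate c (S n))).
  - intros n; symmetry; now apply term_telescopes.
  - now apply certificate_lim.
Qed.

(** * Evaluation by squeezing between even integers *)

(** The product of (c+2i+3/2)(c+2i+5/2)/(c+2i+1)^2 over i < n equals
    (c+3/2)_{2n} / (4^n ((c+1)/2)_n^2). The duplication
    (c+1)_{2n} = 4^n ((c+1)/2)_n (c/2+1)_n, used with c+1 rather than c so
    that c = 0 is admitted, turns it into two ratios at distance 1/2. *)
Lemma Series_term_iterate (c : R) (n : nat) : 0 <= c ->
  Series (term (c + 2 * INR n)) =
  Series (term c) * (half_step (c + 1) (2 * n) * half_step ((c + 1) / 2) n).
Proof.
  intros Hc; induction n as [|n IH].
  - unfold half_step; simpl; rewrite Rmult_0_r, Rplus_0_r; field.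
  - pose proof (pos_INR n).
    pose proof (Series_term_shift (c + 2 * INR n) ltac:(lra)) as Hstep.
    rewrite IH in Hstep.
    rewrite S_INR.
    replace (c + 2 * (INR n + 1)) with (c + 2 * INR n + 2) by ring.
    replace (2 * S n)%nat with (S (S (2 * n))) by lia.
    rewrite !half_step_S, S_INR, mult_INR by lra; simpl (INR 2).
    apply Rmult_eq_reg_l with ((c + 2 * INR n + 1) ^ 2);
      [rewrite Hstep; field; lra | apply pow_nonzero; lra].
Qed.

(** The limit is the same for every offset [m], so both ends of the squeeze
    have the same growth. *)
Lemma half_step_product_lim (x y : R) (m : nat) : 1 / 4 < x -> 1 / 4 < y ->
  is_lim_seq (fun n =>
    (half_step x (2 * (n + m)) * half_step y (n + m)) ^ 2 / (2 * INR n ^ 2))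
    (half_step_rate x * half_step_rate y).
Proof.
  intros Hx Hy.
  apply is_lim_seq_ext_loc with (fun n =>
    half_step x (2 * (n + m)) ^ 2 / INR (2 * (n + m)) *
    (half_step y (n + m) ^ 2 / INR (n + m)) *
    ((INR n + INR m) / (INR n + 0) * ((INR n + INR m) / (INR n + 0)))).
  - exists 1%nat; intros n Hn; apply le_INR in Hn; simpl in Hn.
    rewrite mult_INR, plus_INR; simpl (INR 2); pose proof (pos_INR m).
    field; lra.
  - replace (Finite _) with (Finite
      (half_step_rate x * half_step_rate y * (1 * 1))) by (f_equal; ring).
    apply is_lim_seq_mult'; [apply is_lim_seq_mult'|
      apply is_lim_seq_mult'; apply is_lim_seq_shift_ratio].
    + apply (is_lim_seq_incr_n
        (fun k => half_step x (2 * k) ^ 2 / INR (2 * k)) m).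
      apply half_step_lim_subseq; [lra | lia].
    + apply (is_lim_seq_incr_n (fun k => half_step y k ^ 2 / INR k) m).
      now apply half_step_lim.
Qed.

(** In terms of the Gamma function, S(c) = 2 Gamma(c+3/2) Gamma(c/2+1)
    / (Gamma(c+1) Gamma((c+1)/2)). With m the integer part of c, S(c+2n) lies
    between S(2n) and S(2(n+m+1)), which are explicit; all three, squared and
    divided by 2n^2, have limits. *)
Lemma Series_term_closed_form (c : R) : 0 <= c ->
  Series (term c) ^ 2 * (half_step_rate (c + 1) * half_step_rate ((c + 1) / 2)) = 4.
Proof.
  intros Hc.
  assert (Heven : forall n, Series (term (2 * INR n)) =
    half_step 1 (2 * n) * half_step (1 / 2) n).
  { intros n.
    replace (2 * INR n) with (0 + 2 * INR n) by ring.
    rewrite Series_term_iterate, Series_term_0 by lra.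
    replace (0 + 1) with 1 by ring; ring. }
  destruct (nfloor_ex c Hc) as [m [_ Hm]].
  apply (lim_unique (fun n => Series (term (c + 2 * INR n)) ^ 2 / (2 * INR n ^ 2))).
  - apply is_lim_seq_ext with (fun n => Series (term c) ^ 2 *
      ((half_step (c + 1) (2 * (n + 0)) * half_step ((c + 1) / 2) (n + 0)) ^ 2
       / (2 * INR n ^ 2))).
    + intros n; rewrite Series_term_iterate, Nat.add_0_r by lra.
      unfold Rdiv; ring.
    + apply is_lim_seq_mult'; [apply is_lim_seq_const|].
      apply half_step_product_lim; lra.
  - apply is_lim_seq_le_le_loc with
      (fun n => (half_step 1 (2 * (n + 0)) * half_step (1 / 2) (n + 0)) ^ 2
        / (2 * INR n ^ 2))
      (fun n => (half_step 1 (2 * (n + S m)) * half_step (1 / 2) (n + S m)) ^ 2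
        / (2 * INR n ^ 2)).
    + exists 1%nat; intros n Hn; apply le_INR in Hn; simpl in Hn.
      rewrite <- !Heven, Nat.add_0_r, plus_INR, S_INR.
      pose proof (pos_INR m).
      assert (0 < / (2 * INR n ^ 2)) by (apply Rinv_0_lt_compat; nra).
      split; (apply Rmult_le_compat_r; [lra|]; apply pow_incr; split;
        [apply Series_term_nonneg | apply Series_term_le]; lra).
    + rewrite <- half_step_rate_1_half; apply half_step_product_lim; lra.
    + rewrite <- half_step_rate_1_half; apply half_step_product_lim; lra.
Qed.

Lemma half_step_rate_value :
  half_step_rate (10 / 3) * half_step_rate (5 / 3) = 4 * (384 / 935) ^ 2 / 3.
Proof.
  replace (10 / 3) with (1 / 3 + 1 + 1 + 1) by field.
  replace (5 / 3) with (2 / 3 + 1) by field.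
  rewrite !half_step_rate_shift by lra.
  transitivity (half_step_rate (1 / 3) * half_step_rate (2 / 3) *
    (4 * (384 / 935) ^ 2 / 36)); [field | rewrite half_step_rate_thirds; field].
Qed.

Theorem mainTheorem20 :
  is_series
    (fun j : nat =>
       (1 / 4) ^ j *
       ((rising (1 / 2) j * rising (5 / 3) j * rising (7 / 3) j) /
        (rising 1 j * rising (23 / 12) j * rising (29 / 12) j)) *
       (9 * INR j + 10))
    (935 * sqrt 3 / 128).
Proof.
  assert (Hval : Series (term (7 / 3)) = 935 / 384 * sqrt 3).
  { apply Rsqr_inj.
    - apply Series_term_nonneg; lra.
    - pose proof (sqrt_pos 3); lra.
    - pose proof (Series_term_closed_form (7 / 3) ltac:(lra)) as H.
      replace (7 / 3 + 1) with (10 / 3) in H by field.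
      replace (10 / 3 / 2) with (5 / 3) in H by field.
      rewrite half_step_rate_value in H.
      rewrite Rsqr_mult, Rsqr_sqrt by lra; unfold Rsqr; lra. }
  replace (935 * sqrt 3 / 128) with (3 * Series (term (7 / 3)))
    by (rewrite Hval; field).
  apply is_series_ext with (fun j => 3 * term (7 / 3) j).
  - intros j; unfold term, coef.
    replace ((7 / 3 + 1) / 2) with (5 / 3) by field.
    replace ((7 / 3 + 3 / 2) / 2) with (23 / 12) by field.
    replace ((7 / 3 + 5 / 2) / 2) with (29 / 12) by field.
    match goal with |- @eq _ ?a ?b => change (@eq R a b) end.
    replace (9 * INR j + 10) with (3 * (3 * INR j + 7 / 3 + 1)) by field.
    unfold Rdiv; ring.
  - apply (is_series_scal_l (V := R_NormedModule) 3).
    apply Series_correct, ex_series_term; lra.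
Qed.
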